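(* Let $k\ge 1$, $b>0$, $c>0$ be integers such that $b+c=q^s$ for some integer $s>0$ and prime $q$. Then there exist nonnegative integers $l_1,\dots,l_k$ such that the infinite circulant graph $C_\infty(l_1,\dots,l_k)$ with $k$ distances has a perfect $2$-colouring with parameters $(b,c)$ if and only if $$b+c\le 2k+\gcd(b,c).$$
   Context: Graphs may have loops and multiple edges. The infinite circulant graph with $k$ distances $C_\infty(l_1,\dots,l_k)$ has vertex set $\mathbb{Z}$, and numbers differing by $l_i$, for some $i$, are joined by an edge; it is $2k$-regular, the neighbours of a vertex $g$, counted with multiplicity, being $g+l_i$ and $g-l_i$ for $i=1,\dots,k$. (The $l_i$ are not required to be distinct or nonzero.) A perfect $2$-colouring with parameters $(b,c)$ of a regular graph is a colouring of its vertices in two colours (black and white) such that each black vertex has exactly $b$ white neighbours and each white vertex has exactly $c$ black neighbours (neighbours counted with multiplicity). *)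

(* Defs.v *)
From mathcomp Require Import all_boot all_order all_algebra.

Set Implicit Arguments.
Unset Strict Implicit.
Unset Printing Implicit Defensive.

Local Open Scope ring_scope.

(* A graph with loops and multiple edges, on a possibly infinite vertex type V,
   is given by the list of neighbours of each vertex, repeated according to
   multiplicity. *)

(* Neighbours of g in C_oo(l_1, ..., l_k). A distance l_i = 0 contributes g
   twice, and repeated distances contribute repeated neighbours. *)
Definition circulant_nbrs (k : nat) (l : k.-tuple nat) (g : int) : seq int :=
  [seq g + x%:Z | x : nat <- l] ++ [seq g - x%:Z | x : nat <- l].

(* true stands for black and false for white. *)
Definition perfect_2colouring (V : Type) (nbrs : V -> seq V) (b c : nat)
    (col : V -> bool) : Prop :=
  forall v : V,
    (col v -> count (fun w => ~~ col w) (nbrs v) = b) /\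
    (~~ col v -> count (fun w => col w) (nbrs v) = c).

(* Main.v *)
Require Import Defs.
From mathcomp Require Import all_boot all_order all_algebra all_field.
From mathcomp Require Import zify.

(* Put n = b + c, a power of q. Adding n - 2k loops at every vertex turns a perfect colouring with
   n > 2k into a multiset X of n translations such that every translate of X meets the black set
   in exactly c points. Such a colouring is periodic, because its values on a window determine the
   next one. If N is the period and q^m || N, the Fourier relation says that at every primitive
   root of order q^j, 1 <= j <= m, either the generating polynomial of X or that of the black set
   vanishes. Every vanishing of the latter makes the number of black points in a period, cN/n,
   divisible by one more q, as Phi_{q^j}(1) = q; so this happens for at most v_q(cN/n) indices j,
   and X vanishes at the other ones. Every vanishing of X at order q^j means that exactly one
   q-th of the elements of X divisible by q^(j-1) are divisible by q^j. So X contains 0 at most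
   q^v_q(c) = gcd(b, c) times, while it was built to contain it at least n - 2k times.

   Conversely, with d = gcd(b, c) and m = n / d, colour v black if v mod m < c / d, and choose the
   distances so that the neighbours of v run d times through all nonzero residues mod m; this
   works unless m is even and d is odd, i.e. d = 1 and q = 2, where odd distances are used. *)

Set Implicit Arguments.
Unset Strict Implicit.
Unset Printing Implicit Defensive.
Import Order.TTheory GRing.Theory Num.Theory.

(** * Window sums and counts of black neighbours *)

Lemma big_window_shift (T : Type) (idx : T) (op : Monoid.com_law idx)
    (m : nat) (f : nat -> T) (w : nat) :
    (forall t, f (t + m) = f t) ->
  \big[op/idx]_(i < m) f (w + i) = \big[op/idx]_(i < m) f i.
Proof.
case: m => [|m] fm; first by rewrite !big_ord0.
elim: w => [|w IH]; first by apply: eq_bigr => i _; rewrite add0n.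
rewrite -IH big_ord_recr big_ord_recl /= addn0 addSnnS fm Monoid.mulmC.
by congr (op _ _); apply: eq_bigr => i _; rewrite addSnnS.
Qed.

Definition nbrs_sum (col : int -> bool) (l : seq nat) (v : int) : nat :=
  \sum_(x <- l) (col (v + x%:Z)%R + col (v - x%:Z)%R).

(** One additive equation covers both colours: a white vertex has [c] black neighbours, a black one
    [2 * k - b]. *)
Lemma perfect_2colouringP (k b c : nat) (l : k.-tuple nat) (col : int -> bool) :
  perfect_2colouring (circulant_nbrs l) b c col <->
  forall v, nbrs_sum col l v + (b + c) * col v = c + 2 * k * col v.
Proof.
have cE v : count col (circulant_nbrs l v) = nbrs_sum col l v.
  by rewrite /nbrs_sum big_split /= count_cat !count_map -!sumn_count !sumnE !big_map.
have cNE v : nbrs_sum col l v + count (fun w => ~~ col w) (circulant_nbrs l v) = 2 * k.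
  by rewrite -cE (count_predC col) size_cat !size_map size_tuple; lia.
split=> H v; have := cNE v; have := H v.
  rewrite cE; case: (col v) => /= [] [Hb Hc]; first by rewrite (Hb isT); lia.
  by rewrite (Hc isT); lia.
by rewrite cE; case: (col v) => /=; split=> // _; lia.
Qed.

(** Each missing distance is taken to be 0; it adds [2 * col v] to both sides of the equation. *)
Lemma pad_zero (k b c : nat) (l : seq nat) (col : int -> bool) :
    size l <= k ->
    (forall v, nbrs_sum col l v + (b + c) * col v = c + 2 * size l * col v) ->
  exists (l : k.-tuple nat) (col : int -> bool),
    perfect_2colouring (circulant_nbrs l) b c col.
Proof.
move=> le_lk colP.
have szl : size (l ++ nseq (k - size l) 0) == k by rewrite size_cat size_nseq; lia.
exists (Tuple szl), col; apply/perfect_2colouringP => v.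
rewrite /nbrs_sum big_cat /= big_nseq iter_addn_0 addr0 ?subr0.
by have := colP v; rewrite /nbrs_sum; case: (col v); nia.
Qed.

(** * Construction of the colouring *)

Lemma sum_window_modz (m c : nat) (w : int) : c <= m ->
  (\sum_(i < m) (((w + i%:Z) %% m)%Z < c%:Z)%R) = c.
Proof.
have [-> |m_gt0 le_cm] := posnP m; first by rewrite leqn0 big_ord0 => /eqP.
pose f (t : nat) : nat := ((t%:Z %% m)%Z < c%:Z)%R.
have fm t : f (t + m) = f t by rewrite /f PoszD modzDr.
rewrite (eq_bigr (fun i : 'I_m => f (`|w %% m|%Z + i))); last first.
  move=> i _; rewrite /f PoszD gez0_abs ?modz_ge0 ?modzDml //.
  by rewrite -lt0n.
rewrite big_window_shift // /f.
rewrite (eq_bigr (fun i : 'I_m => nat_of_bool (i < c))); last first.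
  by move=> i _; rewrite modz_nat modn_small.
rewrite -(big_mkord xpredT (fun i => nat_of_bool (i < c))) (big_cat_nat (leq0n c) le_cm) /=.
rewrite [X in X + _](eq_big_nat _ _ (F2 := fun=> 1)); last by move=> i /andP[_ ->].
rewrite [X in _ + X]big_nat_cond [X in _ + X]big1; last first.
  by move=> i /andP[] /andP[+ _] _; rewrite leqNgt => /negbTE ->.
by rewrite sum_nat_const_nat; lia.
Qed.

Lemma sum_flatten_nseq (d : nat) (s : seq nat) (f : nat -> nat) :
  \sum_(x <- flatten (nseq d s)) f x = d * \sum_(x <- s) f x.
Proof. by rewrite big_flatten big_nseq iter_addn_0 mulnC. Qed.

Lemma perfect_2colouring_exists (k b c q s : nat) :
    0 < b -> 0 < c -> prime q -> b + c = q ^ s ->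
    b + c <= 2 * k + gcdn b c ->
  exists (l : k.-tuple nat) (col : int -> bool),
    perfect_2colouring (circulant_nbrs l) b c col.
Proof.
move=> b_gt0 c_gt0 q_pr bcE; set d := gcdn b c => le_bc.
have d_gt0 : 0 < d by rewrite gcdn_gt0 b_gt0.
have /dvdnP[b' b'E] : d %| b by apply: dvdn_gcdl.
have /dvdnP[c' c'E] : d %| c by apply: dvdn_gcdr.
pose m := b' + c'.
have nE : b + c = d * m by rewrite /m; nia.
have m_gt0 : 0 < m by rewrite /m; nia.
have le_cm : c' <= m by rewrite /m; lia.
pose col (v : int) := ((v %% m)%Z < c'%:Z)%R.
have win (w : int) : \sum_(0 <= i < m) col (w + i%:Z)%R = c'.
  by rewrite big_mkord sum_window_modz.
case: (boolP (odd m)) => [m_odd | m_even].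
  (* The window of length [m] centred at [v] is [v] together with all [v + i] and [v - i],
     [1 <= i <= h]; each distance is used [d] times. *)
  pose h := m./2; have mE : m = (2 * h).+1 by rewrite -(odd_double_half m) m_odd /h; lia.
  have sz : size (flatten (nseq d (iota 1 h))) = d * h.
    by rewrite size_flatten /shape map_nseq sumn_nseq size_iota mulnC.
  apply: (@pad_zero _ _ _ (flatten (nseq d (iota 1 h))) col); rewrite sz; first by nia.
  move=> v; rewrite /nbrs_sum sum_flatten_nseq big_split /=.
  have := win (v - h%:Z)%R; rewrite mE (@big_cat_nat _ _ _ h) //=; last by lia.
  rewrite [X in (_ + X)%N]big_ltn; last by lia.
  rewrite subrK big_nat_rev /= => winv.
  have E1 : (\sum_(h.+1 <= i < (2 * h).+1) col (v - h%:Z + i%:Z)%R =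
             \sum_(i <- iota 1 h) col (v + i%:Z)%R).
    rewrite -[h.+1]add1n big_addn /index_iota.
    rewrite (_ : (2 * h).+1 - h - 1 = h); last by lia.
    by apply: eq_bigr => i _; congr (nat_of_bool (col _)); lia.
  have E2 : (\sum_(0 <= i < h) col (v - h%:Z + (0 + h - i.+1)%N%:Z)%R =
             \sum_(i <- iota 1 h) col (v - i%:Z)%R).
    rewrite [RHS](_ : _ = \sum_(1 <= i < h.+1) col (v - i%:Z)%R); last first.
      by rewrite /index_iota subSS subn0.
    rewrite big_add1 /=.
    by apply: eq_big_nat => i i_lt; congr (nat_of_bool (col _)); lia.
  move: winv; rewrite E1 E2 nE mE; set x := \sum_(_ <- _) _; set y := \sum_(_ <- _) _.
  by case: (col v); nia.
have m1E v : \sum_(i <- iota 1 m.-1) col (v + i%:Z)%R + col v = c'.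
  rewrite -(win v) big_ltn // addr0 addnC; congr addn.
  by rewrite /index_iota subn1.
have m2E v : \sum_(i <- iota 1 m.-1) col (v - i%:Z)%R + col v = c'.
  rewrite -(win (v - m.-1%:Z)%R) [in RHS](_ : index_iota 0 m = index_iota 0 m.-1.+1);
    last by rewrite prednK.
  rewrite big_nat_recr //= subrK; congr addn.
  rewrite big_nat_rev /=.
  rewrite [LHS](_ : _ = \sum_(1 <= i < m.-1.+1) col (v - i%:Z)%R); last first.
    by rewrite /index_iota subSS subn0.
  rewrite big_add1 /=.
  by apply: eq_big_nat => i i_lt; congr (nat_of_bool (col _)); lia.
case: (boolP (odd d)) => [d_odd | d_even].
  have d1 : d = 1.
    (* [d] is a power of [q], and [q] is even because [m] is, so an odd [d] is 1. *)
    have : d %| q ^ s by rewrite -bcE nE dvdn_mulr.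
    case/(dvdn_pfactor _ _ q_pr) => t _ dE.
    have : ~~ odd (q ^ s) by rewrite -bcE nE oddM negb_and m_even orbT.
    rewrite oddX negb_or => /andP[_] q_even.
    by move: d_odd; rewrite dE oddX (negPf q_even) orbF => /eqP ->.
  (* The neighbours v - (m - 1), v - (m - 3), ..., v + (m - 1) have consecutive halves. *)
  pose h := m./2; have mE : m = 2 * h by rewrite -(odd_double_half m) (negPf m_even) /h; lia.
  (* The degree [2 * h] is now [b + c], so vertices of both colours need exactly [c] black
     neighbours. *)
  apply: (@pad_zero _ _ _ [seq (2 * i).+1 | i <- iota 0 h] (fun v => col (v %/ 2)%Z)).
    by rewrite size_map size_iota; lia.
  move=> v; rewrite size_map size_iota /nbrs_sum big_map big_split /=.
  have := win ((v + 1 - m%:Z) %/ 2)%Z; rewrite (@big_cat_nat _ _ _ h) //=; last by lia.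
  have E1 : (\sum_(h <= i < m) col (((v + 1 - m%:Z) %/ 2)%Z + i%:Z)%R =
             \sum_(i <- iota 0 h) col ((v + (2 * i).+1%:Z) %/ 2)%Z).
    rewrite -[h]add0n big_addn /index_iota subn0 add0n.
    rewrite (_ : m - h = h); last by lia.
    by apply: eq_bigr => i _; congr (nat_of_bool (col _)); lia.
  have E2 : (\sum_(0 <= i < h) col (((v + 1 - m%:Z) %/ 2)%Z + (0 + h - i.+1)%N%:Z)%R =
             \sum_(i <- iota 0 h) col ((v - (2 * i).+1%:Z) %/ 2)%Z).
    rewrite [in RHS](_ : iota 0 h = index_iota 0 h); last by rewrite /index_iota subn0.
    by apply: eq_big_nat => i i_lt; congr (nat_of_bool (col _)); lia.
  rewrite big_nat_rev /= E1 E2 nE; set x := \sum_(_ <- _) _; set y := \sum_(_ <- _) _.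
  by case: (col _); nia.
(* The distances [1, ..., m - 1] reach every nonzero residue twice, once on each side, so [d / 2]
   copies suffice. *)
pose u := d./2; have dE : d = 2 * u by rewrite -(odd_double_half d) (negPf d_even) /u; lia.
have sz : size (flatten (nseq u (iota 1 m.-1))) = u * m.-1.
  by rewrite size_flatten /shape map_nseq sumn_nseq size_iota mulnC.
apply: (@pad_zero _ _ _ (flatten (nseq u (iota 1 m.-1))) col); rewrite sz; first by nia.
move=> v; rewrite /nbrs_sum sum_flatten_nseq big_split /=.
move: (m1E v) (m2E v); rewrite nE; set x := \sum_(_ <- _) _; set y := \sum_(_ <- _) _.
by case: (col v); nia.
Qed.

(** * Integer polynomials vanishing at roots of unity *)

Section PrimePowerRoots.

Local Open Scope ring_scope.

Lemma prim_root_inv (F : fieldType) (n : nat) (z : F) :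
  n.-primitive_root z -> n.-primitive_root z^-1.
Proof.
move=> z_prim; have n_gt0 := prim_order_gt0 z_prim.
have -> : z^-1 = z ^+ n.-1.
  by rewrite -[LHS]mul1r -(prim_expr_order z_prim) -{1}(prednK n_gt0) exprSr
    mulfK // (prim_root_eq0 z_prim) -lt0n.
by rewrite prim_root_exp_coprime // coprime_sym -{1}(prednK n_gt0) coprimeSn.
Qed.

(** The minimal polynomial of [z] over the rationals is cyclotomic, of degree [totient n], which
    exceeds that of [p]. *)
Lemma int_poly_root_eq0 (n : nat) (z : algC) (p : {poly int}) :
    n.-primitive_root z -> (size p <= totient n)%N ->
    root (map_poly intr p) z -> p = 0.
Proof.
move=> z_prim le_p pz.
have [r [r_min r_monic rP]] := minCpolyP z.
have szr : size r = (totient n).+1.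
  by rewrite -(size_map_poly (ratr : rat -> algC)) -r_min
    (minCpoly_cyclotomic z_prim) size_cyclotomic.
have pE : map_poly intr p = map_poly ratr (map_poly intr p : {poly rat}) :> {poly algC}.
  by rewrite -map_poly_comp; apply: eq_map_poly => a /=; rewrite ratr_int.
have szp : size (map_poly intr p : {poly rat}) = size p.
  by rewrite size_map_inj_poly //; apply: intr_inj.
apply/eqP; rewrite -size_poly_eq0 -szp size_poly_eq0; apply/negPn/negP => p_neq0.
move: pz; rewrite pE rP => /(dvdp_leq p_neq0).
by rewrite szr szp ltnNge le_p.
Qed.

(** ['Phi_n] is monic, so division with remainder stays over the integers; the remainder vanishes at
    [z] and has too small a degree. *)
Lemma Cyclotomic_dvd (n : nat) (z : algC) (p : {poly int}) :
    n.-primitive_root z -> root (map_poly intr p) z ->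
  exists r, p = 'Phi_n * r.
Proof.
move=> z_prim pz; have Phi_monic := Cyclotomic_monic n.
have pE := Pdiv.RingMonic.rdivp_eq Phi_monic p.
exists (Pdiv.Ring.rdivp p 'Phi_n); rewrite {1}pE mulrC.
suff -> : Pdiv.Ring.rmodp p 'Phi_n = 0 by rewrite addr0.
apply: (int_poly_root_eq0 z_prim).
  by rewrite -ltnS -(size_Cyclotomic n) Pdiv.Ring.ltn_rmodpN0 // monic_neq0.
move: pz; rewrite {1}pE rmorphD rmorphM /= (Cintr_Cyclotomic z_prim) !rootE hornerD hornerM.
have /eqP -> : (cyclotomic z n).[z] == 0 by rewrite -rootE root_cyclotomic.
by rewrite mulr0 add0r.
Qed.

Lemma root_primitive_conj (n : nat) (z w : algC) (p : {poly int}) :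
    n.-primitive_root z -> n.-primitive_root w ->
  root (map_poly intr p) z -> root (map_poly intr p) w.
Proof.
move=> z_prim w_prim /(Cyclotomic_dvd z_prim)[r ->].
by rewrite rmorphM /= (Cintr_Cyclotomic w_prim) rootM root_cyclotomic // w_prim.
Qed.

(** The polynomial is [1 + Y + ... + Y^(q-1)] with [Y = 'X^(q ^ j)]. *)
Lemma horner1_Cyclotomic_prime_power (q j : nat) : prime q ->
  ('Phi_(q ^ j.+1)).[1] = q%:R.
Proof.
move=> q_pr; have q_gt1 := prime_gt1 q_pr.
have e_gt0 : (0 < q ^ j)%N by rewrite expn_gt0 prime_gt0.
have eS_gt0 : (0 < q ^ j.+1)%N by rewrite expn_gt0 prime_gt0.
have [z z_prim] := C_prim_root_exists eS_gt0.
pose p : {poly int} := \sum_(i < q) 'X^(q ^ j) ^+ i.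
have pE : ('X^(q ^ j) - 1) * p = 'X^(q ^ j.+1) - 1.
  by rewrite /p -subrX1 -exprM expnSr.
have mon1 : ('X^(q ^ j) - 1 : {poly int}) \is monic by rewrite monicXnsubC.
have mon2 : ('X^(q ^ j.+1) - 1 : {poly int}) \is monic by rewrite monicXnsubC.
have p_monic : p \is monic by rewrite -(monicMl _ mon1) pE.
have szp : size p = (totient (q ^ j.+1)).+1.
  have := congr1 (size : {poly int} -> nat) pE.
  rewrite size_Mmonic ?monic_neq0 // !size_XnsubC // totient_pfactor //= expnS.
  by move: (prednK (prime_gt0 q_pr)); nia.
suff <- : p = 'Phi_(q ^ j.+1).
  by rewrite horner_sum (eq_bigr (fun=> 1)) ?sumr_const ?card_ord // => i _;
    rewrite !hornerE !expr1n.
(* Both polynomials are monic of degree [totient (q ^ j.+1)], so their difference has smaller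
   degree, yet it vanishes at [z]. *)
apply/eqP; rewrite -subr_eq0; apply/eqP; apply: (int_poly_root_eq0 z_prim).
  apply/leq_sizeP => i; rewrite coefB leq_eqVlt => /predU1P[<-|lt_i]; last first.
    by rewrite !nth_default ?subrr ?szp ?size_Cyclotomic.
  have -> : p`_(totient (q ^ j.+1)) = 1 by rewrite -[RHS](monicP p_monic) lead_coefE szp.
  rewrite -(monicP (Cyclotomic_monic (q ^ j.+1))) lead_coefE size_Cyclotomic.
  by rewrite subrr.
rewrite rmorphB /= (Cintr_Cyclotomic z_prim) rootE hornerD hornerN.
have /eqP -> : (cyclotomic z (q ^ j.+1)).[z] == 0 by rewrite -rootE root_cyclotomic.
rewrite subr0.
have /(congr1 (fun r : {poly int} => (map_poly intr r).[z])) := pE.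
rewrite rmorphM !rmorphB /= !map_polyXn rmorph1 hornerM !hornerE.
rewrite (prim_expr_order z_prim) subrr => /eqP; rewrite mulf_eq0 => /orP[|//].
rewrite subr_eq0 -(prim_order_dvd z_prim) dvdn_Pexp2l // ltnn //.
Qed.

(** The cyclotomic factors for distinct orders split off one by one, each contributing [q] to the
    value at 1. *)
Lemma expn_dvd_horner1 (q : nat) (J : seq nat) (p : {poly int}) :
    prime q -> uniq J ->
    (forall j (z : algC), j \in J -> (q ^ j.+1).-primitive_root z -> root (map_poly intr p) z) ->
  (q ^ size J %| `|p.[1]|)%N.
Proof.
move=> q_pr; elim: J p => [|j J IH] p /=; first by rewrite dvd1n.
move=> /andP[jJ uJ] pJ.
have eS_gt0 : (0 < q ^ j.+1)%N by rewrite expn_gt0 prime_gt0.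
have [z z_prim] := C_prim_root_exists eS_gt0.
have [r pE] := Cyclotomic_dvd z_prim (pJ _ _ (mem_head _ _) z_prim).
rewrite pE hornerM horner1_Cyclotomic_prime_power // abszM natz /= expnS dvdn_mul //.
apply: IH => // i w iJ w_prim.
have /[!pE] : root (map_poly intr p) w by apply: pJ w_prim; rewrite inE iJ orbT.
rewrite rmorphM /= (Cintr_Cyclotomic z_prim) rootM root_cyclotomic // => /orP[w_prim'|//].
have := prim_order_dvd w_prim' (q ^ i.+1); rewrite (prim_expr_order w_prim) eqxx.
have := prim_order_dvd w_prim (q ^ j.+1); rewrite (prim_expr_order w_prim') eqxx.
rewrite !dvdn_Pexp2l ?prime_gt1 // => le1 le2.
by move: jJ; rewrite (_ : j = i) ?iJ //; lia.
Qed.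

(** * Generating polynomials of multisets of translations *)

Definition exp_poly (X : seq nat) : {poly int} := \sum_(x <- X) 'X^x.

Lemma horner_exp_poly (X : seq nat) (z : algC) :
  (map_poly intr (exp_poly X)).[z] = \sum_(x <- X) z ^+ x.
Proof.
rewrite rmorph_sum horner_sum /=; apply: eq_bigr => x _.
by rewrite map_polyXn hornerXn.
Qed.

(** Root-of-unity filter: the powers [z ^+ (i * x)] sum to [n] if [n] divides [x], and to 0
    otherwise. *)
Lemma sum_exp_poly_roots (X : seq nat) (n : nat) (z : algC) :
    n.-primitive_root z ->
  \sum_(i < n) (map_poly intr (exp_poly X)).[z ^+ i] = (n * count (dvdn n) X)%:R.
Proof.
move=> z_prim; under eq_bigr do rewrite horner_exp_poly.
rewrite exchange_big /= -sum1_count big_distrr /= natr_sum [RHS]big_mkcond /=.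
apply: eq_bigr => x _.
under eq_bigr do rewrite exprAC.
have := subrX1 (z ^+ x) n.
rewrite exprAC (prim_expr_order z_prim) expr1n subrr (prim_order_dvd z_prim).
case: eqP => [-> _|zx /esym/eqP].
  by under eq_bigr do rewrite expr1n; rewrite sumr_const card_ord muln1.
by rewrite mulf_eq0 subr_eq0 => /orP[/eqP//|/eqP].
Qed.

(** The filters for orders [q ^ j.+1] and [q ^ j] have equal sums, since [X] vanishes at all
    conjugates of [z]. *)
Lemma count_dvdn_root (X : seq nat) (q j : nat) (z : algC) :
    prime q -> (q ^ j.+1).-primitive_root z -> root (map_poly intr (exp_poly X)) z ->
  count (dvdn (q ^ j)) X = (q * count (dvdn (q ^ j.+1)) X)%N.
Proof.
move=> q_pr z_prim Xz; have q_gt0 := prime_gt0 q_pr.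
have zq_prim : (q ^ j).-primitive_root (z ^+ q).
  have := exp_prim_root z_prim q.
  by rewrite expnSr gcdnMl mulnK.
have := sum_exp_poly_roots X z_prim; rewrite expnSr.
(* Only the roots z ^+ i with q | i, i.e. those of order dividing q ^ j, contribute. *)
rewrite -(big_mkord xpredT (fun i => (map_poly intr (exp_poly X)).[z ^+ i])) big_nat_mul.
rewrite big_mkord (eq_bigr (fun i : 'I_(q ^ j) =>
   (map_poly intr (exp_poly X)).[(z ^+ q) ^+ i])); last first.
  move=> i _; rewrite mulSn addnC big_ltn; last by lia.
  rewrite big_nat_cond big1; first by rewrite Monoid.mulm1 -exprM mulnC.
  move=> k /andP[/andP[lt_k k_lt] _]; apply/eqP; rewrite -rootE.
  apply: (root_primitive_conj z_prim) => //.
  rewrite prim_root_exp_coprime // coprimeXr // coprime_sym prime_coprime //.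
  apply/negP => /dvdnP[r kE].
  move: lt_k k_lt; rewrite kE addnC -mulSn !ltn_pmul2r // ltnS; lia.
rewrite (sum_exp_poly_roots X zq_prim) => /eqP; rewrite eqr_nat -mulnA eqn_pmul2l; last first.
  by rewrite expn_gt0 q_gt0.
by move/eqP.
Qed.

(** Passing from [q ^ j] to [q ^ j.+1] divides the count by [q] if [X] vanishes there, and never
    increases it. *)
Lemma expn_count_dvdn_le (X : seq nat) (q m : nat) (z : nat -> algC) :
    prime q -> (forall j, (q ^ j.+1).-primitive_root (z j)) ->
  (q ^ count (fun j => root (map_poly intr (exp_poly X)) (z j)) (iota 0 m) *
     count (dvdn (q ^ m)) X <= size X)%N.
Proof.
move=> q_pr z_prim; elim: m => [|m IH]; first by rewrite mul1n count_size.
apply: leq_trans IH; rewrite -[m.+1]addn1 iotaD count_cat /= add0n addn0 addn1.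
case: (boolP (root _ (z m))) => [Xz|_] /=; last first.
  rewrite addn0 leq_mul2l; apply/orP; right; apply: sub_count => x /=.
  by apply: dvdn_trans; rewrite dvdn_exp2l.
by rewrite addn1 expnSr -mulnA -(count_dvdn_root q_pr (z_prim m) Xz).
Qed.

(* The set with indicator function g meets every translate of the multiset X in c points. *)
Section PeriodicTiling.

Variables (N c : nat) (X : seq nat) (g : nat -> nat).
Hypothesis gN : forall t, g (t + N) = g t.
Hypothesis sumX : forall t, (\sum_(x <- X) g (t + x) = c)%N.

(** Double counting of [g (t + x)] over one period of [t] and all [x] in [X]. *)
Lemma sum_period : (size X * \sum_(t < N) g t = c * N)%N.
Proof.
have : (\sum_(t < N) \sum_(x <- X) g (t + x) = N * c)%N.
  by under eq_bigr do rewrite sumX; rewrite sum_nat_const card_ord.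
rewrite exchange_big /= (eq_bigr (fun=> \sum_(t < N) g t))%N.
  by rewrite big_const_seq count_predT iter_addn_0 => gE; rewrite mulnC gE mulnC.
move=> x _; rewrite -(big_window_shift _ x gN).
by apply: eq_bigr => t _; rewrite addnC.
Qed.

Definition period_poly : {poly int} := \sum_(t < N) 'X^t *+ g t.

Lemma horner1_period_poly : period_poly.[1] = (\sum_(t < N) g t)%N%:R.
Proof.
rewrite horner_sum natr_sum; apply: eq_bigr => t _.
by rewrite hornerMn hornerXn expr1n.
Qed.

(** Substituting [t + x] for [t] turns the product of the two values into [c] times the sum of
    [w^-1 ^+ t] over a period, which is 0. *)
Lemma root_exp_or_period_poly (w : algC) : w ^+ N = 1 -> w != 1 ->
  root (map_poly intr (exp_poly X)) w || root (map_poly intr period_poly) w^-1.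
Proof.
move=> wN w1; rewrite !rootE -mulf_eq0 horner_exp_poly.
have [N0|N_gt0] := posnP N.
  by rewrite /period_poly N0 big_ord0 rmorph0 horner0 mulr0.
have w_neq0 : w != 0.
  by apply: contra_eq_neq wN => ->; rewrite expr0n gtn_eqF // eq_sym oner_neq0.
have -> : (map_poly intr period_poly).[w^-1] = \sum_(t < N) (g t)%:R * w^-1 ^+ t.
  rewrite rmorph_sum horner_sum /=; apply: eq_bigr => t _.
  by rewrite rmorphMn /= map_polyXn hornerMn hornerXn mulr_natl.
rewrite mulr_suml (eq_bigr (fun x => \sum_(t < N) (g (t + x))%:R * w^-1 ^+ t)).
  rewrite exchange_big /=.
  under eq_bigr do rewrite -mulr_suml -natr_sum sumX.
  rewrite -mulr_sumr mulf_eq0; apply/orP; right.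
  have /esym/eqP := subrX1 w^-1 N.
  by rewrite exprVn wN invr1 subrr mulf_eq0 subr_eq0 invr_eq1 (negPf w1).
move=> x _.
rewrite -(@big_window_shift _ _ _ N (fun t => (g t)%:R * w^-1 ^+ t) x); last first.
  by move=> t; rewrite gN exprD [w^-1 ^+ N]exprVn wN invr1 mulr1.
rewrite big_distrr; apply: eq_bigr => t _ /=.
by rewrite mulrCA exprD [w ^+ x * _]mulrA -exprMn mulfV // expr1n mul1r addnC.
Qed.

Lemma periodic_tiling_count0 (q s : nat) :
    prime q -> size X = (q ^ s)%N -> (0 < c)%N -> (0 < N)%N ->
  (count_mem 0%N X <= gcdn c (q ^ s))%N.
Proof.
move=> q_pr szX c_gt0 N_gt0; have q_gt0 := prime_gt0 q_pr.
have gcd_gt0 : (0 < gcdn c (q ^ s))%N by rewrite gcdn_gt0 c_gt0.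
(* If [q ^ s] divides [c], the bound is just [size X]. *)
have [le_st|lt_ts] := leqP s (logn q c).
  have /gcdn_idPr -> : (q ^ s %| c)%N.
    by apply: dvdn_trans (pfactor_dvdnn q c); rewrite dvdn_exp2l.
  by rewrite -szX count_size.
have le_gcd : (q ^ logn q c <= gcdn c (q ^ s))%N.
  by rewrite dvdn_leq // dvdn_gcd pfactor_dvdnn dvdn_exp2l // ltnW.
apply: leq_trans le_gcd.
have z_ex j : {z : algC | (q ^ j.+1).-primitive_root z}.
  by apply: C_prim_root_exists; rewrite expn_gt0 q_gt0.
pose z j := sval (z_ex j).
have z_prim j : (q ^ j.+1).-primitive_root (z j) by rewrite /z; case: (z_ex j).
pose m := logn q N; pose K j := root (map_poly intr (exp_poly X)) (z j).
have := expn_count_dvdn_le X m q_pr z_prim; rewrite -/K szX => le_a.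
have le_0 : (count_mem 0%N X <= count (dvdn (q ^ m)) X)%N.
  by apply: sub_count => x /= /eqP ->; rewrite dvdn0.
(* At these orders [X] does not vanish, so the period polynomial must. *)
pose J := [seq j <- iota 0 m | ~~ K j].
have J_dvd : (q ^ size J %| \sum_(t < N) g t)%N.
  have := @expn_dvd_horner1 q J period_poly q_pr _ _.
  rewrite horner1_period_poly natz /=; apply; first by rewrite filter_uniq // iota_uniq.
  move=> j w; rewrite mem_filter mem_iota /= add0n => /andP[NKj lt_jm] w_prim.
  have zj_prim : (q ^ j.+1).-primitive_root (z j)^-1.
    exact: prim_root_inv.
  apply: (root_primitive_conj zj_prim w_prim).
  have := @root_exp_or_period_poly (z j); rewrite -/(K j) (negPf NKj) /=; apply.
    apply/eqP; rewrite -(prim_order_dvd (z_prim j)).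
    by apply: dvdn_trans (pfactor_dvdnn q N); rewrite dvdn_exp2l.
  rewrite -[z j]expr1 -(prim_order_dvd (z_prim j)) dvdn1.
  by rewrite gtn_eqF // -{1}(expn0 q) ltn_exp2l // prime_gt1.
have szJ : (count K (iota 0 m) + size J = m)%N.
  by rewrite size_filter (count_predC K) size_iota.
have gE := sum_period; rewrite szX in gE.
have g_gt0 : (0 < \sum_(t < N) g t)%N.
  by have : (0 < c * N)%N; [rewrite muln_gt0 c_gt0 | rewrite -gE muln_gt0 => /andP[]].
(* With [v] the [q]-adic valuation and [G] the sum of [g] over a period, [s + v(G) = v(c) + m] and
   [size J <= v(G)]; hence [K] holds at least [s - v(c)] times. *)
have := congr1 (logn q) gE.
rewrite !lognM ?expn_gt0 ?q_gt0 // pfactorK //.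
have : (size J <= logn q (\sum_(t < N) g t))%N by rewrite -pfactor_dvdn.
move=> le_J logE.
have le_K : (s - logn q c <= count K (iota 0 m))%N by rewrite -/m in logE; lia.
rewrite -(@leq_pmul2l (q ^ (s - logn q c))) ?expn_gt0 ?q_gt0 //.
rewrite -expnD subnK; last by exact: ltnW.
apply: leq_trans le_a; apply: leq_mul => //.
by rewrite leq_exp2l // prime_gt1.
Qed.

End PeriodicTiling.

End PrimePowerRoots.

(** * Periodicity of the colouring *)

(** By pigeonhole two windows of length [M] coincide, and from there on the sequence repeats. *)
Lemma finite_memory_periodic (T : finType) (M : nat) (h : nat -> T) :
    (forall t u, (forall a, a < M -> h (t + a) = h (u + a)) -> h (t + M) = h (u + M)) ->
  exists i N, 0 < N /\ forall t, h (i + t + N) = h (i + t).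
Proof.
move=> hM; pose W i : {ffun 'I_M -> T} := [ffun a : 'I_M => h (i + a)].
have [i [N [N_gt0 WE]]] : exists i N, 0 < N /\ W (i + N) = W i.
  pose f (i : 'I_(#|{ffun 'I_M -> T}|.+1)) := W i.
  have /injectivePn[i [j]] : ~~ injectiveb f.
    by apply/negP => /injectiveP/leq_card; rewrite card_ord ltnn.
  rewrite -(inj_eq val_inj) neq_ltn /f => ij Wij.
  case/orP: ij => lt_ij; [exists i, (j - i) | exists j, (i - j)];
    by rewrite subn_gt0 lt_ij subnKC // ltnW.
exists i, N; split=> // t; rewrite addnAC.
elim/ltn_ind: t => t IH; have [lt_tM|le_Mt] := ltnP t M.
  by have /ffunP/(_ (Ordinal lt_tM)) := WE; rewrite !ffunE.
rewrite -(subnK le_Mt) !addnA; apply: hM => a lt_aM.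
by have := IH (t - M + a); rewrite !addnA; apply; lia.
Qed.

Lemma ltn_sum_seq (l : seq nat) (F G : nat -> nat) (y : nat) :
    (forall x, x \in l -> F x <= G x) -> y \in l -> F y < G y ->
  \sum_(x <- l) F x < \sum_(x <- l) G x.
Proof.
move=> le_FG yl lt_y; rewrite !(big_rem y yl) /= -addSn leq_add //.
by rewrite !big_seq leq_sum // => x /mem_rem /le_FG.
Qed.

(** Among the neighbours only [v + L] and [w + L] can differ in colour, so the equal totals decide.
    Swapping [v] and [w] gives equality. *)
Lemma nbrs_sum_memory (col : int -> bool) (l : seq nat) (e c L : nat) (v w : int) :
    0 < L -> L \in l -> (forall x, x \in l -> x <= L) ->
    nbrs_sum col l v + e * col v = c -> nbrs_sum col l w + e * col w = c ->
    (forall x : int, (- L%:Z <= x)%R -> (x < L%:Z)%R -> col (v + x)%R = col (w + x)%R) ->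
  col (v + L%:Z)%R <= col (w + L%:Z)%R.
Proof.
move=> L_gt0 Ll lL vE wE vw; rewrite leqNgt; apply/negP => lt_L.
have vwE : col v = col w by have := vw 0%R; rewrite !addr0; apply; lia.
suff : nbrs_sum col l w < nbrs_sum col l v by rewrite vwE in vE; lia.
apply: (@ltn_sum_seq _ _ _ L) => // [x xl|].
  have := lL x xl; rewrite leq_eqVlt => /predU1P[->|lt_x].
    by rewrite (vw (- L%:Z)%R); [rewrite leq_add2r ltnW | lia | lia].
  by rewrite (vw x) ?(vw (- x%:Z)%R) //; lia.
by rewrite (vw (- L%:Z)%R) ?ltn_add2r //; lia.
Qed.

(** * Necessity of the inequality *)

Lemma perfect_2colouring_bound (k b c q s : nat) (l : k.-tuple nat) (col : int -> bool) :
    0 < b -> 0 < c -> prime q -> b + c = q ^ s ->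
    perfect_2colouring (circulant_nbrs l) b c col ->
  b + c <= 2 * k + gcdn b c.
Proof.
move=> b_gt0 c_gt0 q_pr bcE /perfect_2colouringP colP.
have [le_bc|lt_bc] := leqP (b + c) (2 * k); first by apply: leq_trans le_bc (leq_addr _ _).
pose e := b + c - 2 * k.
have eE v : nbrs_sum col l v + e * col v = c.
  by have := colP v; rewrite /e; case: (col v); lia.
pose L := \max_(x <- l) x.
have lL x : x \in l -> x <= L by move=> xl; rewrite /L (big_rem x xl) leq_maxl.
have [L0|L_gt0] := posnP L.
  (* With all distances 0 a vertex sees only its own colour, forcing [b = 0] or [c = 0]. *)
  have l0 v : nbrs_sum col l v = 2 * k * col v.
    rewrite /nbrs_sum big_seq (eq_bigr (fun=> 2 * col v)).
      by rewrite -big_seq big_const_seq count_predT size_tuple iter_addn_0; lia.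
    move=> x /lL; rewrite L0 leqn0 => /eqP ->.
    by rewrite addr0 ?subr0 addnn mul2n.
  by have := colP 0%R; rewrite l0; case: (col _); lia.
have Ll : L \in l.
  suff : L \in 0 :: l by rewrite inE gtn_eqF.
  rewrite /L; elim: (tval l) => [|x r IH]; first by rewrite big_nil.
  rewrite big_cons !inE; case: leqP => _; last by rewrite eqxx orbT.
  by move: IH; rewrite inE => /orP[->|->]; rewrite ?orbT.
pose h (t : nat) := col t%:Z%R.
have [i [N [N_gt0 hN]]] : exists i N, 0 < N /\ forall t, h (i + t + N) = h (i + t).
  (* Seen from the centre [t + L], the value to determine is that of the farthest neighbour on the
     right. *)
  apply: (@finite_memory_periodic _ (2 * L)) => t u tu.
  have win (x : int) : (- L%:Z <= x)%R -> (x < L%:Z)%R ->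
      col ((t + L)%N%:Z + x)%R = col ((u + L)%N%:Z + x)%R.
    move=> le_x x_lt; have := tu `|(x + L%:Z)%R|%N; rewrite /h => H.
    rewrite (_ : (_ + x)%R = (t + `|(x + L%:Z)%R|%N)%N); last by lia.
    by rewrite H; [congr col; lia | lia].
  rewrite /h (_ : Posz (t + 2 * L) = ((t + L)%N%:Z + L%:Z)%R); last by lia.
  rewrite (_ : Posz (u + 2 * L) = ((u + L)%N%:Z + L%:Z)%R); last by lia.
  have le1 := nbrs_sum_memory L_gt0 Ll lL (eE _) (eE _) win.
  have le2 := nbrs_sum_memory L_gt0 Ll lL (eE _) (eE _) (fun x l1 l2 => esym (win x l1 l2)).
  by move: le1 le2; do 2!case: (col _).
pose g t : nat := h (i + t).
have gN t : g (t + N) = g t by rewrite /g addnA hN.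
have gMN m t : g (t + m * N) = g t.
  by elim: m => [|m IH]; rewrite ?addn0 // mulSnr addnA gN IH.
(* By periodicity, translation by x * (N - 1) agrees with translation by - x. *)
pose X := l ++ [seq x * N.-1 | x <- l] ++ nseq e 0.
have szX : size X = q ^ s.
  by rewrite !size_cat size_map size_nseq size_tuple -bcE /e; lia.
have sumX t : \sum_(x <- X) g (t + x) = c.
  rewrite /X !big_cat big_map big_nseq iter_addn_0 /= addnA -big_split /= addn0.
  (* Moving right by [L] periods keeps [v - x] at or beyond [i], where periodicity is known. *)
  rewrite -(eE (Posz (i + (t + L * N)))) /nbrs_sum [e * _]mulnC -(gMN L t); congr (_ + _).
  rewrite !big_seq; apply: eq_bigr => x /lL le_xL; congr (_ + _).
    by rewrite -(gMN L) /g /h; congr (nat_of_bool (col _)); lia.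
  have le_xLN : x <= L * N by apply: leq_trans le_xL (leq_pmulr _ _).
  transitivity (g (t + L * N - x)); last by rewrite /g /h; congr (nat_of_bool (col _)); lia.
  rewrite -(gMN x (_ - x)) -(gMN L (t + _)); congr g.
  have := mulnSr x N.-1; rewrite prednK //; lia.
(* [X] holds at least [e = b + c - 2 * k] zeros, and [gcdn c (b + c)] is [gcdn b c]. *)
have := periodic_tiling_count0 gN sumX q_pr szX c_gt0 N_gt0.
rewrite -bcE gcdnDr [gcdn c b]gcdnC !count_cat (count_nseq _ e) /= mul1n /e; lia.
Qed.

Theorem theorem3 (k b c q s : nat) (hk : 1 <= k) (hb : 0 < b) (hc : 0 < c)
    (hq : prime q) (hs : 0 < s) (hbc : b + c = q ^ s) :
  (exists (l : k.-tuple nat) (col : int -> bool),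
      perfect_2colouring (circulant_nbrs l) b c col)
  <-> b + c <= 2 * k + gcdn b c.
Proof.
split=> [[l [col colP]]|]; first exact: (perfect_2colouring_bound hb hc hq hbc colP).
exact: (perfect_2colouring_exists hb hc hq hbc).
Qed.
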